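(* Define $$\chi_3(k)=\begin{cases}0&k\equiv0\bmod 3\\1&k\equiv1\bmod3\\-1&k\equiv2\bmod3\end{cases}\qquad\text{and}\qquad \lambda(k)=\begin{cases}1&k\equiv0\bmod3\\0&k\not\equiv0\bmod3.\end{cases}$$ For every integer $n\ge0$, the $n$-th iterated integral $f_n$ of $\ln(1+x^3)$ (for $x>-1$) can be written as $$f_n(x)=A_{n,3}(x)+B_{n,3}(x)\,\sqrt3\arctan\!\left(\frac{1-2x}{\sqrt3}\right)+C_{n,3}(x)\ln(x+1)+D_{n,3}(x)\ln(x^2-x+1)$$ with $A_{n,3}\in\mathbb{Q}[\sqrt3\,\pi,x]$ and $B_{n,3},C_{n,3},D_{n,3}\in\mathbb{Q}[x]$, where $$B_{n,3}(x)=-\frac1{n!}\sum_{k=0}^n\chi_3(n-k)\binom nk x^k,$$ $$C_{n,3}(x)=\frac1{n!}(x+1)^n=\frac{1}{n!}\sum_{k=0}^n\binom nk x^k,$$ $$D_{n,3}(x)=\frac{1}{2\,n!}\sum_{k=0}^n\left(3\lambda(n-k)-1\right)\binom nk x^k.$$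
   Context: The iterated integrals are defined by $f_0(x)=\ln(1+x^3)$ and $f_n(x)=\int_0^x f_{n-1}(t)\,dt$ for $n\ge1$. $\mathbb{Q}[\sqrt3\,\pi,x]$ denotes the ring of polynomial expressions in the real number $\sqrt3\,\pi$ and the variable $x$ with rational coefficients. *)

(* Defs.v *)
From HB Require Import structures.
From mathcomp Require Import all_boot all_order all_algebra.
From mathcomp Require Import all_classical all_reals all_analysis.

Set Implicit Arguments.
Unset Strict Implicit.
Unset Printing Implicit Defensive.

Import Order.TTheory GRing.Theory Num.Theory.
Import numFieldNormedType.Exports.

Local Open Scope classical_set_scope.
Local Open Scope ring_scope.

(* [\int[mu]_(t in D) _] is not oriented, while the iterated integrals below are
   also taken from 0 to a negative x. *)
Definition oriented_integral (R : realType) (a b : R) (f : R -> R) : R :=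
  if a <= b then \int[@lebesgue_measure R]_(t in `[a, b]) f t
  else - \int[@lebesgue_measure R]_(t in `[b, a]) f t.

Fixpoint iter_int_ln (R : realType) (n : nat) (x : R) : R :=
  match n with
  | 0 => ln (1 + x ^+ 3)
  | m.+1 => oriented_integral 0 x (iter_int_ln m)
  end.

Definition chi3 (k : nat) : int :=
  if k == 1 %[mod 3] then 1 else if k == 2 %[mod 3] then -1 else 0.

Definition lambda3 (k : nat) : int := if k == 0 %[mod 3] then 1 else 0.

(* [A] lies in Q[c, x]: it is obtained from a polynomial in x whose
   coefficients are rational polynomials in y by substituting c for y. *)
Definition in_rat_adjoin_X (R : realType) (c : R) (A : {poly R}) : Prop :=
  exists P : {poly {poly rat}},
    A = \poly_(i < size P) (map_poly ratr P`_i).[c].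

(* Main.v *)
Require Import Defs.
From HB Require Import structures.
From mathcomp Require Import all_boot all_order all_algebra.
From mathcomp Require Import all_classical all_reals all_analysis.
From mathcomp Require Import ring lra.

Set Implicit Arguments.
Unset Strict Implicit.
Unset Printing Implicit Defensive.

Import Order.TTheory GRing.Theory Num.Theory.
Import numFieldNormedType.Exports.

Local Open Scope ring_scope.

(* The polynomials B, C, D are Appell sequences: each is the derivative of the
   next one. Hence differentiating the claimed form of f_{n+1} gives the form of
   f_n, plus a rational function coming from the derivatives of the arctangent
   and the logarithms. With w a primitive cube root of 1, u = x + w and
   v = x + w^2, one has uv = x^2 - x + 1, D_n = (u^n + v^n) / (2 n!) and
   B_n = - (u^n - v^n) / (n! (u - v)), so that x^2 - x + 1 divides
   (2x - 1) D_{n+1} - 3/2 B_{n+1}, with quotient 2 D_n / (n+1); the rational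
   function is therefore the polynomial (C_n + 2 D_n) / (n+1). Then A_{n+1} is
   an antiderivative of A_n - (C_n + 2 D_n) / (n+1), normalized at 0 by
   arctan (1 / sqrt 3) = pi / 6, which is where sqrt 3 * pi enters. *)

(** * Appell sequences *)

Section Appell.
Variable K : comNzRingType.
Implicit Types (c : nat -> K) (n : nat).

(** The sequence is determined by its values [c n] at 0; for [c m] = w^m it is (x + w)^n. *)
Definition appell c n : {poly K} :=
  \sum_(k < n.+1) (c (n - k)%N * 'C(n, k)%:R) *: 'X^k.

Lemma coef_appell c n k :
  (appell c n)`_k = if (k <= n)%N then c (n - k)%N * 'C(n, k)%:R else 0.
Proof.
rewrite -ltnS /appell -(poly_def n.+1 (fun k => c (n - k)%N * 'C(n, k)%:R)).
by rewrite coef_poly.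
Qed.

(** Pascal's rule on each coefficient. A linear relation between [c] and its shift thus becomes a
    recurrence in [n]. *)
Lemma appellS c n : appell c n.+1 = 'X * appell c n + appell (c \o S) n.
Proof.
apply/polyP => k; rewrite coefD coefXM !coef_appell /=.
case: k => [|k] /=; first by rewrite !subn0 !bin0 add0r.
rewrite ltnS subSS binS natrD mulrDr addrC; case: ltngtP => [kn|_|->].
- by rewrite -subSn.
- by rewrite addr0.
- by rewrite (@bin_small n n.+1)// mulr0.
Qed.

(** Induction with [c] general, since [appellS] shifts it: the product rule yields one copy of the
    preceding term, and the two induction hypotheses recombine into the other copies. *)
Lemma deriv_appell c n : (appell c n.+1)^`() = n.+1%:R *: appell c n.
Proof.
elim: n c => [|n IH] c; rewrite appellS derivD derivM derivX mul1r.
  rewrite [appell _ 0]big_ord1 [appell _ 0]big_ord1 expr0 !derivZ derivC.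
  by rewrite !scaler0 mulr0 !addr0 scale1r.
rewrite !IH -scalerAr -addrA -scalerDr -appellS.
by rewrite [in RHS]mulrS scalerDl scale1r.
Qed.

End Appell.

(** * Recurrences for the sums with chi3 and lambda3 *)

Definition chi3_poly n : {poly rat} := appell (fun m => (chi3 m)%:~R) n.
Definition lambda3_poly n : {poly rat} :=
  appell (fun m => (3 * lambda3 m - 1)%:~R) n.

(** For w = (-1 + sqrt(-3)) / 2, one has 2 w^m = (3 lambda3(m) - 1) + sqrt(-3) chi3(m); this and
    [lambda3S] are the two components of multiplication by w. *)
Lemma chi3S m : 2 * chi3 m.+1 = (3 * lambda3 m - 1) - chi3 m.
Proof.
rewrite /chi3 /lambda3 -[m.+1]addn1 -(modnDml m).
by have := ltn_pmod m (isT : 0 < 3)%N; case: (m %% 3)%N => [|[|[|]]].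
Qed.

Lemma lambda3S m :
  2 * (3 * lambda3 m.+1 - 1) = - (3 * lambda3 m - 1) - 3 * chi3 m.
Proof.
rewrite /chi3 /lambda3 -[m.+1]addn1 -(modnDml m).
by have := ltn_pmod m (isT : 0 < 3)%N; case: (m %% 3)%N => [|[|[|]]].
Qed.

(** Together with [lambda3_polyS], this is multiplication of (x + w)^n by x + w, split into
    components. *)
Lemma chi3_polyS n :
  2 *: chi3_poly n.+1 = (2 *: 'X - 1) * chi3_poly n + lambda3_poly n.
Proof.
rewrite /chi3_poly appellS scalerDr mulrBl mul1r -scalerAl -addrA.
congr (_ + _).
apply/polyP => k; rewrite !(coefZ, coefD, coefN) !coef_appell /=.
case: leqP => _; last by rewrite mulr0 oppr0 addr0.
have := congr1 (fun z : int => z%:~R : rat) (chi3S (n - k)).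
rewrite rmorphM rmorphB /= => E.
by rewrite mulrA E mulrBl addrC.
Qed.

Lemma lambda3_polyS n :
  2 *: lambda3_poly n.+1 = (2 *: 'X - 1) * lambda3_poly n - 3 *: chi3_poly n.
Proof.
rewrite /lambda3_poly appellS scalerDr mulrBl mul1r -scalerAl -addrA.
congr (_ + _).
apply/polyP => k; rewrite !(coefZ, coefD, coefN) !coef_appell /=.
case: leqP => _; last by rewrite !mulr0 oppr0 addr0.
have := congr1 (fun z : int => z%:~R : rat) (lambda3S (n - k)).
rewrite rmorphM (rmorphB _ (- _)) (rmorphN _ (3 * _ - 1)) /=.
rewrite (rmorphM _ 3 (chi3 _)) => E.
by rewrite mulrA E mulrBl mulNr mulrA.
Qed.

Lemma chi3_lambda3_polyS n :
  3 *: chi3_poly n.+1 + (2 *: 'X - 1) * lambda3_poly n.+1 =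
  2 *: (('X ^+ 2 - 'X + 1) * lambda3_poly n).
Proof.
(* Doubling lets both recurrences apply; what remains is (2x - 1)^2 + 3 = 4 (x^2 - x + 1). *)
have two0 : (2 : rat) != 0 by [].
apply: (scalerI two0); rewrite scalerDr scalerA [2 * 3]mulrC -scalerA scalerAr.
rewrite chi3_polyS lambda3_polyS -!mul_polyC; ring.
Qed.

(** * Real analysis: integrals and derivatives *)

Section Analysis.
Variable R : realType.

(** The triple-angle formula gives cos (3t) = 0, and 0 < t < pi / 4 leaves only 3t = pi / 2. *)
Lemma atan_inv_sqrt3 : atan (Num.sqrt 3)^-1 = pi / 6 :> R.
Proof.
set t := atan _; have s3_gt0 : 0 < Num.sqrt (3 : R) by rewrite sqrtr_gt0.
have t_gt0 : 0 < t by rewrite -(atan0 R) lt_atan// invr_gt0.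
have t_lt : t < pi / 4.
  rewrite -atan1 lt_atan// invf_lt1//.
  by rewrite -[ltLHS]sqrtr1 ltr_sqrt// ltr1n.
have cos_t : cos t ^+ 2 = 3 / 4.
  rewrite cos_atan exprVn sqr_sqrtr; last by rewrite addr_ge0// sqr_ge0.
  by rewrite exprVn sqr_sqrtr//; field.
have cos_3t : cos (3 * t) = 0.
  rewrite (_ : 3 * t = t + (t + t)); last by ring.
  rewrite !(cosD, sinD).
  have := cos2Dsin2 t; rewrite cos_t => sin_t.
  have {}sin_t : sin t ^+ 2 = 1 / 4 by lra.
  transitivity (cos t * (cos t ^+ 2 - 3 * sin t ^+ 2)); first by ring.
  by rewrite cos_t sin_t (_ : _ - _ = 0) ?mulr0//; field.
have pi0 := pi_gt0 R.
have : 3 * t = pi / 2.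
  apply: cos_inj; rewrite ?cos_pihalf// in_itv/=; apply/andP; split; lra.
lra.
Qed.

Lemma Rintegral_FTC2 (F f : R -> R) (a b : R) : a <= b ->
  (forall x : R, x \in `[a, b] -> is_derive x 1 F (f x)) ->
  (forall x : R, x \in `[a, b] -> derivable f x 1) ->
  \int[@lebesgue_measure R]_(t in `[a, b]%classic) f t = F b - F a.
Proof.
rewrite le_eqVlt => /predU1P[<-|ab] dF df.
  by rewrite set_itv1 Rintegral_set1 subrr.
have cF : {within `[a, b], continuous F}%classic.
  by apply: derivable_within_continuous => x /dF dFx; exact: ex_derive.
rewrite /Rintegral (@continuous_FTC2 _ f F)//.
- exact: derivable_within_continuous.
- have [_ Fa Fb] := (continuous_within_itvP F ab).1 cF.
  by split => // x /subset_itv_oo_cc /dF dFx; exact: ex_derive.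
- by move=> x /subset_itv_oo_cc /dF dFx; rewrite derive1E; exact: derive_val.
Qed.

(** The half-line above [a] contains 0 and x, hence the segment between them in either order. *)
Lemma oriented_integral_FTC (F f : R -> R) (a : R) : a < 0 ->
  (forall x : R, a < x -> is_derive x 1 F (f x)) ->
  (forall x : R, a < x -> derivable f x 1) ->
  forall x, a < x -> oriented_integral 0 x f = F x - F 0.
Proof.
move=> a0 dF df x ax; rewrite /oriented_integral; case: ifPn => [x0|].
  by apply: Rintegral_FTC2 => // t; rewrite in_itv/= => /andP[t0 _];
    [apply: dF|apply: df]; exact: lt_le_trans t0.
rewrite -ltNge => /ltW x0.
rewrite -(opprB (F 0)); congr (- _).
apply: Rintegral_FTC2 => // t; rewrite in_itv/= => /andP[t0 _];
  [apply: dF|apply: df]; exact: lt_le_trans t0.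
Qed.

Lemma eq_oriented_integral (f g : R -> R) (a : R) : a < 0 ->
  (forall x : R, a < x -> f x = g x) ->
  forall x, a < x -> oriented_integral 0 x f = oriented_integral 0 x g.
Proof.
move=> a0 fg x ax; rewrite /oriented_integral; case: ifPn => [x0|].
  apply: eq_Rintegral => t; rewrite inE/= in_itv/= => /andP[t0 _].
  by rewrite fg//; exact: lt_le_trans t0.
rewrite -ltNge => /ltW x0; congr (- _).
apply: eq_Rintegral => t; rewrite inE/= in_itv/= => /andP[t0 _].
by rewrite fg//; exact: lt_le_trans t0.
Qed.

Definition log_atan_form (A B C D : {poly R}) (x : R) : R :=
  A.[x] + B.[x] * Num.sqrt 3 * atan ((1 - 2 * x) / Num.sqrt 3)
  + C.[x] * ln (x + 1) + D.[x] * ln (x ^+ 2 - x + 1).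

Lemma is_derive_log_atan_form (A B C D : {poly R}) (x : R) : -1 < x ->
  is_derive x 1 (log_atan_form A B C D)
    (log_atan_form A^`() B^`() C^`() D^`() x
     + (C.[x] / (x + 1)
        + ((2 * x - 1) * D.[x] - 3 / 2 * B.[x]) / (x ^+ 2 - x + 1))).
Proof.
move=> x1.
have s3 : Num.sqrt (3 : R) != 0 by rewrite lt0r_neq0// sqrtr_gt0.
have s3E : Num.sqrt (3 : R) ^+ 2 = 3 by rewrite sqr_sqrtr.
have x1_gt0 : 0 < x + 1 by lra.
have q_gt0 : 0 < x ^+ 2 - x + 1 by nra.
have dp (p : {poly R}) := is_derive_poly p x.
(* The denominator comes from 1 + (1 - 2x)^2 / 3 = (4/3) (x^2 - x + 1). *)
have datan : is_derive x 1 (fun x => atan ((1 - 2 * x) / Num.sqrt 3))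
    (- Num.sqrt 3 / 2 / (x ^+ 2 - x + 1)).
  apply: (@is_derive_eq _ _ _ _ _ _ _ _ (is_derive1_comp _ _)).
  rewrite !scaler0 add0r /GRing.scale/= exprMn exprVn s3E.
  rewrite (_ : (Num.sqrt 3)^-1 = Num.sqrt 3 / 3); last first.
    by apply: (mulfI s3); rewrite divff// mulrA -expr2 s3E divff.
  field; apply/andP; split; apply: lt0r_neq0; nra.
have dln1 : is_derive x 1 (fun x => ln (x + 1)) (x + 1)^-1.
  have dln := is_derive1_ln x1_gt0.
  apply: (@is_derive_eq _ _ _ _ _ _ _ _ (is_derive1_comp _ _)).
  by rewrite addr0 mulr1.
have dln2 : is_derive x 1 (fun x => ln (x ^+ 2 - x + 1))
    ((2 * x - 1) / (x ^+ 2 - x + 1)).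
  have dln := is_derive1_ln q_gt0.
  apply: (@is_derive_eq _ _ _ _ _ _ _ _ (is_derive1_comp _ _)).
  rewrite /GRing.scale/=; ring.
rewrite /log_atan_form.
apply: is_derive_eq.
rewrite /GRing.scale/= mulr0 add0r.
set s : R := Num.sqrt 3 in s3E *; clearbody s.
have -> : B.[x] * s * (- s / 2 / (x ^+ 2 - x + 1))
    = - (s ^+ 2 / 2) * B.[x] / (x ^+ 2 - x + 1) by ring.
rewrite s3E; ring.
Qed.

(** Both denominators cancel, so the rational part of the derivative is absorbed into the polynomial
    part. *)
Lemma is_derive_log_atan_form_poly (A B C D E G : {poly R}) (x : R) :
  -1 < x ->
  C = G * ('X + 1) ->
  (2 *: 'X - 1) * D - (3 / 2) *: B = E * ('X ^+ 2 - 'X + 1) ->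
  is_derive x 1 (log_atan_form A B C D)
    (log_atan_form (A^`() + (E + G)) B^`() C^`() D^`() x).
Proof.
move=> x1 CG DBE; apply: is_derive_eq (is_derive_log_atan_form A B C D x1) _.
have x1_neq0 : x + 1 != 0 by apply: lt0r_neq0; lra.
have q_neq0 : x ^+ 2 - x + 1 != 0 by apply: lt0r_neq0; nra.
have -> : (2 * x - 1) * D.[x] - 3 / 2 * B.[x] = E.[x] * (x ^+ 2 - x + 1).
  by have := congr1 (horner^~ x) DBE; rewrite !hornerE.
have -> : C.[x] = G.[x] * (x + 1) by rewrite CG !hornerE.
rewrite /log_atan_form !hornerD !mulfK//; ring.
Qed.

Lemma log_atan_form0 (A B C D : {poly R}) :
  log_atan_form A B C D 0 = A.[0] + B.[0] * Num.sqrt 3 * (pi / 6).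
Proof.
rewrite /log_atan_form mulr0 subr0 mul1r atan_inv_sqrt3 expr2 mul0r subr0 add0r.
by rewrite ln1 !mulr0 !addr0.
Qed.

End Analysis.

(** * Antiderivatives of polynomials *)

Definition primitive (K : fieldType) (p : {poly K}) : {poly K} :=
  \poly_(i < (size p).+1) (p`_i.-1 / i%:R).

(* The junk value [0^-1 = 0] makes the constant coefficient 0. *)
Lemma coef_primitive (K : fieldType) (p : {poly K}) i :
  (primitive p)`_i = p`_i.-1 / i%:R.
Proof.
rewrite coef_poly; case: ltnP => //; case: i => // i le_i.
by rewrite nth_default// mul0r.
Qed.

Lemma deriv_primitive (K : numFieldType) (p : {poly K}) :
  (primitive p)^`() = p.
Proof.
apply/polyP => i; rewrite coef_deriv coef_primitive /=.
by rewrite -(mulr_natr (_ / _)) divfK// pnatr_eq0.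
Qed.

(** * Closure properties of Q[c, x] *)

Section RatAdjoin.
Variables (R : realType) (c : R).

Let coef_rat_subst (P : {poly {poly rat}}) i :
  (\poly_(j < size P) (map_poly ratr P`_j).[c])`_i = (map_poly ratr P`_i).[c].
Proof.
rewrite coef_poly; case: ltnP => // le_i.
by rewrite nth_default// rmorph0 horner0.
Qed.

(** Membership is tested coefficient by coefficient, which reduces the closure properties to
    Q[c]. *)
Lemma in_rat_adjoin_XP (A : {poly R}) :
  in_rat_adjoin_X c A <->
  forall i, exists q : {poly rat}, A`_i = (map_poly ratr q).[c].
Proof.
split=> [[P ->] i|/choice[q Aq]]; first by exists P`_i; rewrite coef_rat_subst.
exists (\poly_(i < size A) q i); apply/polyP => i.
rewrite coef_rat_subst coef_poly; case: ltnP => [_|le_i]; first exact: Aq.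
by rewrite nth_default// rmorph0 horner0.
Qed.

Lemma in_rat_adjoin_XB (A B : {poly R}) :
  in_rat_adjoin_X c A -> in_rat_adjoin_X c B -> in_rat_adjoin_X c (A - B).
Proof.
move=> /in_rat_adjoin_XP Ac /in_rat_adjoin_XP Bc; apply/in_rat_adjoin_XP => i.
have [[p Ap] [q Bq]] := (Ac i, Bc i).
by exists (p - q); rewrite coefB Ap Bq rmorphB hornerD hornerN.
Qed.

Lemma in_rat_adjoin_X_ratr (p : {poly rat}) :
  in_rat_adjoin_X c (map_poly ratr p).
Proof.
apply/in_rat_adjoin_XP => i; exists (p`_i)%:P.
by rewrite map_polyC hornerC coef_map.
Qed.

Lemma in_rat_adjoin_X_const (p : {poly rat}) :
  in_rat_adjoin_X c (map_poly ratr p).[c]%:P.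
Proof.
apply/in_rat_adjoin_XP => i; exists (if i == 0%N then p else 0).
by rewrite coefC; case: ifP => // _; rewrite rmorph0 horner0.
Qed.

Lemma in_rat_adjoin_X_primitive (A : {poly R}) :
  in_rat_adjoin_X c A -> in_rat_adjoin_X c (primitive A).
Proof.
move=> /in_rat_adjoin_XP Ac; apply/in_rat_adjoin_XP => i.
have [q Aq] := Ac i.-1; exists (i%:R^-1 *: q).
by rewrite coef_primitive Aq map_polyZ hornerZ /= fmorphV /= ratr_nat mulrC.
Qed.

End RatAdjoin.

(** * The rational polynomials B, C, D *)

Definition Bpoly n : {poly rat} := - (n`!%:R^-1 *: chi3_poly n).
Definition Cpoly n : {poly rat} := n`!%:R^-1 *: ('X + 1) ^+ n.
Definition Dpoly n : {poly rat} := (2 * n`!%:R)^-1 *: lambda3_poly n.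

Lemma invf_factS n : (n.+1)`!%:R^-1 = n`!%:R^-1 * n.+1%:R^-1 :> rat.
Proof. by rewrite factS natrM invfM mulrC. Qed.

Lemma deriv_Bpoly n : (Bpoly n.+1)^`() = Bpoly n.
Proof.
by rewrite derivN derivZ deriv_appell scalerA invf_factS divfK.
Qed.

Lemma deriv_Cpoly n : (Cpoly n.+1)^`() = Cpoly n.
Proof.
rewrite derivZ deriv_exp derivD derivX -polyC1 derivC addr0 mul1r.
by rewrite -scaler_nat scalerA invf_factS divfK.
Qed.

Lemma deriv_Dpoly n : (Dpoly n.+1)^`() = Dpoly n.
Proof.
by rewrite derivZ deriv_appell scalerA invfM invf_factS mulrA divfK// -invfM.
Qed.

Lemma CpolyS n : Cpoly n.+1 = (n.+1%:R^-1 *: Cpoly n) * ('X + 1).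
Proof. by rewrite /Cpoly scalerA -scalerAl -exprSr invf_factS mulrC. Qed.

Lemma Cpoly_sum n : Cpoly n = n`!%:R^-1 *: \sum_(k < n.+1) 'C(n, k)%:R *: 'X^k.
Proof.
rewrite /Cpoly addrC exprDn; congr (_ *: _); apply: eq_bigr => k _.
by rewrite expr1n mul1r scaler_nat.
Qed.

(** This is [chi3_lambda3_polyS] divided by 2 (n+1)!. *)
Lemma DpolyS_BpolyS n :
  (2 *: 'X - 1) * Dpoly n.+1 - (3 / 2) *: Bpoly n.+1 =
  ((2 / n.+1%:R) *: Dpoly n) * ('X ^+ 2 - 'X + 1).
Proof.
have /(congr1 (fun p => (2 * n.+1`!%:R)^-1 *: p)) := chi3_lambda3_polyS n.
rewrite /Bpoly /Dpoly scalerN opprK !scalerDr => E.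
transitivity ((2 * n.+1`!%:R)^-1 *: (3 *: chi3_poly n.+1) +
  (2 * n.+1`!%:R)^-1 *: ((2 *: 'X - 1) * lambda3_poly n.+1)).
  rewrite addrC -scalerAr !scalerA; congr (_ *: _ + _).
  by rewrite invfM; ring.
rewrite E -!scalerAl !scalerA (mulrC (lambda3_poly n)); congr (_ *: _).
by rewrite !invfM invf_factS; ring.
Qed.

(** * Induction on the number of integrations *)

Theorem theorem6p1 (R : realType) (n : nat) :
  exists (A : {poly R}) (B C D : {poly rat}),
    [/\ in_rat_adjoin_X (Num.sqrt 3 * pi) A,
        B = - (n`!%:R^-1 *:
                 \sum_(k < n.+1) ((chi3 (n - k))%:~R * 'C(n, k)%:R) *: 'X^k),
        C = n`!%:R^-1 *: ('X + 1) ^+ n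
          /\ C = n`!%:R^-1 *: \sum_(k < n.+1) 'C(n, k)%:R *: 'X^k,
        D = (2 * n`!%:R)^-1 *:
              \sum_(k < n.+1)
                ((3 * lambda3 (n - k) - 1)%:~R * 'C(n, k)%:R) *: 'X^k
      & forall x : R, -1 < x ->
          iter_int_ln n x =
            A.[x]
            + (map_poly ratr B).[x] * Num.sqrt 3 * atan ((1 - 2 * x) / Num.sqrt 3)
            + (map_poly ratr C).[x] * ln (x + 1)
            + (map_poly ratr D).[x] * ln (x ^+ 2 - x + 1)].
Proof.
(* With B, C, D explicit, the induction only has to carry [A]. *)
suff [A [A_adj A_form]] : exists A : {poly R},
    in_rat_adjoin_X (Num.sqrt 3 * pi) A /\ forall x : R, -1 < x ->
      iter_int_ln n x = log_atan_form A (map_poly ratr (Bpoly n))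
        (map_poly ratr (Cpoly n)) (map_poly ratr (Dpoly n)) x.
  exists A, (Bpoly n), (Cpoly n), (Dpoly n).
  by split=> //; split=> //; exact: Cpoly_sum.
elim: n => [|n [A [A_adj A_form]]].
  exists 0; split.
    by apply/in_rat_adjoin_XP => i; exists 0; rewrite coef0 rmorph0 horner0.
  move=> x x1 /=.
  have -> : Bpoly 0 = 0.
    by rewrite /Bpoly /chi3_poly /appell big_ord1 mul0r scale0r scaler0 oppr0.
  have -> : Cpoly 0 = 1 by rewrite /Cpoly expr0 invr1 scale1r.
  have -> : Dpoly 0 = 1.
    rewrite /Dpoly /lambda3_poly /appell big_ord1 expr0 scalerA.
    by rewrite (_ : _ * _ = 1) ?scale1r.
  rewrite /log_atan_form !rmorph0 !rmorph1 !hornerE.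
  rewrite (_ : 1 + x ^+ 3 = (x + 1) * (x ^+ 2 - x + 1)); last by ring.
  by rewrite lnM// posrE; nra.
pose E := map_poly ratr ((2 / n.+1%:R) *: Dpoly n) : {poly R}.
pose G := map_poly ratr (n.+1%:R^-1 *: Cpoly n) : {poly R}.
(* The subtracted constant is the arctangent term at 0, so that the new form vanishes there. *)
pose A1 := primitive (A - (E + G))
  - ((map_poly ratr (Bpoly n.+1)).[0] * Num.sqrt 3 * (pi / 6))%:P.
pose F (m : nat) (A : {poly R}) := log_atan_form A (map_poly ratr (Bpoly m))
  (map_poly ratr (Cpoly m)) (map_poly ratr (Dpoly m)).
exists A1; split.
  apply: in_rat_adjoin_XB.
    apply: in_rat_adjoin_X_primitive; apply: in_rat_adjoin_XB => //.
    by rewrite -rmorphD; exact: in_rat_adjoin_X_ratr.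
  (* Since B(0) is rational, this constant is a rational multiple of sqrt 3 * pi. *)
  have -> : (map_poly ratr (Bpoly n.+1)).[0] * Num.sqrt 3 * (pi / 6) =
      (map_poly ratr (((Bpoly n.+1)`_0 / 6) *: 'X)).[Num.sqrt 3 * pi] :> R.
    rewrite map_polyZ map_polyX hornerZ hornerX horner_coef0 coef_map /=.
    by rewrite fmorph_div /= ratr_nat; ring.
  exact: in_rat_adjoin_X_const.
have F1_deriv (x : R) : -1 < x -> is_derive x 1 (F n.+1 A1) (F n A x).
  move=> x1; rewrite /F.
  have := @is_derive_log_atan_form_poly R A1 (map_poly ratr (Bpoly n.+1))
    (map_poly ratr (Cpoly n.+1)) (map_poly ratr (Dpoly n.+1)) E G x x1.
  rewrite !deriv_map deriv_Bpoly deriv_Cpoly deriv_Dpoly.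
  rewrite derivB derivC subr0 deriv_primitive subrK; apply.
    by rewrite CpolyS rmorphM rmorphD /= map_polyX rmorph1.
  have := congr1 (map_poly (ratr : rat -> R)) (DpolyS_BpolyS n).
  rewrite rmorphB !rmorphM rmorphB /= [map_poly _ (_ *: 'X)]map_polyZ.
  rewrite [map_poly _ (_ *: Bpoly _)]map_polyZ map_polyX rmorph1 /=.
  rewrite [map_poly _ (_ + 1)]rmorphD /= [map_poly _ (_ - 'X)]rmorphB /=.
  rewrite map_polyXn map_polyX rmorph1.
  by rewrite fmorph_div /= !ratr_nat.
(* This gives the continuity of the integrand. *)
have F_derivable (x : R) : -1 < x -> derivable (F n A) x 1.
  move=> x1.
  exact: (@ex_derive _ _ _ _ _ _ _ (is_derive_log_atan_form _ _ _ _ x1)).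
have N1_lt0 : -1 < 0 :> R by rewrite oppr_lt0.
move=> x x1 /=; rewrite -/(F n.+1 A1 x).
rewrite (eq_oriented_integral N1_lt0 A_form x1).
rewrite (oriented_integral_FTC N1_lt0 F1_deriv F_derivable x1).
(* The boundary term at 0 is zero: [primitive] vanishes there and the constant in [A1] cancels the
   arctangent. *)
rewrite [X in _ - X]log_atan_form0 /A1 hornerD hornerN hornerC.
by rewrite !horner_coef0 coef_primitive invr0 mulr0 add0r addNr subr0.
Qed.
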